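(* Let $P=\bigoplus_{k\ge 0}R_k$ be an arbitrary $\mathbb{N}$-graded ring, and let $C^{+}$ be a bounded chain complex of finitely generated free (right) $P$-modules. The following statements are equivalent: (1) The complex $C^{+}\otimes_P R_0$ is contractible, the tensor product being taken with respect to the ring homomorphism $\mathrm{tr}^0\colon P\to R_0$. (2) The induced complex $C^{+}\otimes_P \widehat P$ is contractible. (3) The induced complex $C^{+}\otimes_P \tilde\Omega_+^{-1}P$ is contractible. (4) The map $\zeta\colon C^{+}\otimes_P P_{\ge 1}\to C^{+}\otimes_P P=C^{+}$, $c\otimes x\mapsto cx$, is a quasi-isomorphism.
   Context: All rings are unital (possibly non-commutative), ring homomorphisms preserve $1$, modules are right modules unless stated otherwise. $P=\bigoplus_{k\ge0}R_k$ is an $\mathbb{N}$-graded ring (i.e. $R_kR_l\subseteq R_{k+l}$). $\mathrm{tr}^0\colon P\to R_0$ is the ring homomorphism $\sum_k r_k\mapsto r_0$ (with $r_k\in R_k$). $P_{\ge1}=\bigoplus_{k\ge1}R_k$, a $P$-bimodule. $\widehat P$ is the ring of formal power series $\sum_{k\ge0}r_kt^k$ with $r_k\in R_k$ for all $k$ ($t$ central, usual multiplication); $P$ is the subring of finite sums (identify $r\in R_k$ with $rt^k$). $\tilde\Omega_+$ is the set of all square matrices $M$ (of arbitrary finite size) with entries in $P$ such that $\mathrm{tr}^0(M)$ (entrywise) is invertible over $R_0$. A matrix of size $k$ is regarded as a homomorphism $P^k\to P^k$ of free right $P$-modules. Non-commutative localisation: for a ring $K$ and a set $\Sigma$ of homomorphisms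 of finitely generated projective right $K$-modules, a ring homomorphism $f\colon K\to S$ is $\Sigma$-inverting if $\sigma\otimes_K S$ is an isomorphism for all $\sigma\in\Sigma$; $\lambda_\Sigma\colon K\to\Sigma^{-1}K$ is the initial $\Sigma$-inverting ring homomorphism with domain $K$ (it always exists). $\tilde\Omega_+^{-1}P$ is the localisation of $P$ with respect to $\tilde\Omega_+$. *)

(* Defs.v *)
From HB Require Import structures.
From mathcomp Require Import all_boot all_algebra generic_quotient ring_quotient.
From mathcomp Require Import boolp freeg.

Set Implicit Arguments.
Unset Strict Implicit.
Unset Printing Implicit Defensive.

Import GRing.Theory.
Local Open Scope ring_scope.
Local Open Scope quotient_scope.

(* A right K-module is an [lmodType K^c], a left module over the converse
   ring; [a *: x] stands for the element x a. *)

(* [lact] is the left K-action on the right S-module [bim_car]. *)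
Record bimodule (K S : pzRingType) := Bimodule {
  bim_car :> lmodType S^c;
  lact : K -> bim_car -> bim_car;
  lactA : forall a b x, lact a (lact b x) = lact (a * b) x;
  lact1 : forall x, lact 1 x = x;
  lactDl : forall a b x, lact (a + b) x = lact a x + lact b x;
  lactDr : forall a x y, lact a (x + y) = lact a x + lact a y;
  lactZ : forall a (s : S^c) x, lact a (s *: x) = s *: lact a x }.

(* The tensor product of M and N over K is the free abelian group on M * N
   modulo the subgroup generated by biadditivity and x a (x) n = x (x) a n. *)
Inductive tensor_rel (K S : pzRingType) (M : lmodType K^c) (N : bimodule K S) :
    {freeg (M * N)%type / int} -> Prop :=
| TRel0 : tensor_rel 0
| TRelB u v : tensor_rel u -> tensor_rel v -> tensor_rel (u - v)
| TRelDl (x y : M) (n : N) :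
    tensor_rel (<< (x + y, n) >> - << (x, n) >> - << (y, n) >>)
| TRelDr (x : M) (n p : N) :
    tensor_rel (<< (x, n + p) >> - << (x, n) >> - << (x, p) >>)
| TRelZ (x : M) (a : K^c) (n : N) :
    tensor_rel (<< (a *: x, n) >> - << (x, lact (a : K) n) >>).

Section TensorGroup.
Variables (K S : pzRingType) (M : lmodType K^c) (N : bimodule K S).

Definition tensor_relb : {pred {freeg (M * N)%type / int}} :=
  fun u => `[< tensor_rel u >].

Lemma tensor_rel_closed : zmod_closed tensor_relb.
Proof.
split; first by apply/asboolP; exact: TRel0.
by move=> u v /asboolP Hu /asboolP Hv; apply/asboolP; exact: TRelB.
Qed.

HB.instance Definition _ := GRing.isZmodClosed.Build
  {freeg (M * N)%type / int} tensor_relb tensor_rel_closed.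

Definition tensor := Quotient.quot tensor_relb.
HB.instance Definition _ := GRing.Zmodule.on tensor.
HB.instance Definition _ := Quotient.on tensor.

Definition pure (x : M) (n : N) : tensor := \pi_tensor << (x, n) >>.

Lemma tensor_piB u v : \pi_tensor (u - v) = \pi_tensor u - \pi_tensor v.
Proof. by rewrite Quotient.pi_add Quotient.pi_opp. Qed.

Lemma tensor_pi0 : \pi_tensor 0 = 0.
Proof. by rewrite -[0 in LHS](subrr 0) tensor_piB subrr. Qed.

Lemma tensor_pi_eq0 u : tensor_rel u -> \pi_tensor u = 0.
Proof.
move=> Hu; rewrite -tensor_pi0.
by apply/eqP; rewrite -Quotient.idealrBE subr0; apply/asboolP.
Qed.

Lemma pureDl x y n : pure (x + y) n = pure x n + pure y n.
Proof.
have := tensor_pi_eq0 (TRelDl x y n); rewrite !tensor_piB => /eqP.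
by rewrite -addrA -opprD subr_eq0 => /eqP.
Qed.

Lemma pureDr x n p : pure x (n + p) = pure x n + pure x p.
Proof.
have := tensor_pi_eq0 (TRelDr x n p); rewrite !tensor_piB => /eqP.
by rewrite -addrA -opprD subr_eq0 => /eqP.
Qed.

Lemma pureZ x (a : K^c) n : pure (a *: x) n = pure x (lact (a : K) n).
Proof.
by have /eqP := tensor_pi_eq0 (TRelZ x a n); rewrite !tensor_piB subr_eq0 => /eqP.
Qed.

Lemma tensor_ind (Q : tensor -> Prop) :
  Q 0 -> (forall u v, Q u -> Q v -> Q (u - v)) -> (forall x n, Q (pure x n)) ->
  forall t, Q t.
Proof.
move=> Q0 QB Qp t.
have QN u : Q u -> Q (- u) by move=> Qu; rewrite -sub0r; exact: QB.
have QD u v : Q u -> Q v -> Q (u + v).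
  by move=> Qu Qv; rewrite -[v]opprK; apply: QB => //; exact: QN.
have piN (u : {freeg (M * N)%type / int}) : \pi_tensor (- u) = - \pi_tensor u.
  by rewrite -sub0r tensor_piB tensor_pi0 sub0r.
have piD (u v : {freeg (M * N)%type / int}) :
  \pi_tensor (u + v) = \pi_tensor u + \pi_tensor v.
  by rewrite -[v in LHS]opprK tensor_piB piN opprK.
have Qg k z : Q (\pi_tensor << k *g z >>).
  have gD (a b : int) : << a + b *g z >> = << a *g z >> + << b *g z >>
    :> {freeg (M * N)%type / int}.
    by apply/eqP/freeg_eqP => y; rewrite coeffD !coeffU mulrDl.
  have gN (a : int) : << - a *g z >> = - << a *g z >>
    :> {freeg (M * N)%type / int}.
    by apply/eqP/freeg_eqP => y; rewrite coeffN !coeffU mulNr.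
  have g0 : << (0 : int) *g z >> = 0 :> {freeg (M * N)%type / int}.
    by apply/eqP/freeg_eqP => y; rewrite coeff0 coeffU mul0r.
  elim/int_rec: k => [|m IH|m IH]; first by rewrite g0 tensor_pi0.
    rewrite intS gD piD; apply: QD => //.
    by case: z {gD gN g0 IH} => x n; exact: Qp.
  rewrite intS opprD gD piD; apply: QD => //; rewrite gN piN; apply: QN.
  by case: z {gD gN g0 IH} => x n; exact: Qp.
rewrite -[t]reprK; elim/freeg_ind_dom0: (repr t); first by rewrite tensor_pi0.
by move=> k z D _ _ QD'; rewrite piD; exact: QD.
Qed.

Record balanced (A : zmodType) := Balanced {
  bal_fun :> M -> N -> A;
  balDl : forall x y n, bal_fun (x + y) n = bal_fun x n + bal_fun y n;
  balDr : forall x n p, bal_fun x (n + p) = bal_fun x n + bal_fun x p;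
  balZ : forall x (a : K^c) n, bal_fun (a *: x) n = bal_fun x (lact (a : K) n) }.

Section TensorLift.
Variables (A : zmodType) (f : balanced A).

Definition tensor_lift (t : tensor) : A :=
  fglift (fun z : M * N => f z.1 z.2 : zmodule A) (repr t).

Lemma tensor_lift_pi u :
  tensor_lift (\pi_tensor u) = fglift (fun z : M * N => f z.1 z.2 : zmodule A) u.
Proof.
rewrite /tensor_lift; set F := fglift _.
have FB : zmod_morphism F by exact: lift_is_additive.
have FU z : F << z >> = f z.1 z.2 by rewrite /F liftU scale1r.
pose Fa := GRing.isZmodMorphism.Build _ _ F FB.
pose G : {additive _ -> _} := HB.pack F Fa.
have GU z : G << z >> = f z.1 z.2 by exact: FU.
have G0 v : tensor_rel v -> G v = 0.
  elim=> [|v1 v2 _ H1 _ H2|x y n|x n p|x a n]; rewrite ?raddf0 // ?raddfB.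
  - by rewrite H1 H2 subr0.
  - by rewrite !GU /= balDl -addrA -opprD subrr.
  - by rewrite !GU /= balDr -addrA -opprD subrr.
  - by rewrite !GU /= balZ subrr.
apply/eqP; rewrite -subr_eq0 -[F _ - F _]/(G _ - G _) -raddfB; apply/eqP/G0.
by apply/asboolP; rewrite -[`[< _ >]]/(_ \in tensor_relb) Quotient.idealrBE reprK.
Qed.

Lemma tensor_lift_zmod : zmod_morphism tensor_lift.
Proof.
move=> u v; rewrite -[u]reprK -[v]reprK -tensor_piB !tensor_lift_pi.
exact: (lift_is_additive (fun z : M * N => f z.1 z.2 : zmodule A)).
Qed.

HB.instance Definition _ :=
  GRing.isZmodMorphism.Build tensor A tensor_lift tensor_lift_zmod.

Lemma tensor_liftE x n : tensor_lift (pure x n) = f x n.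
Proof. by rewrite tensor_lift_pi liftU scale1r. Qed.

End TensorLift.

Lemma tensor_ext (A : zmodType) (f g : {additive tensor -> A}) :
  (forall x n, f (pure x n) = g (pure x n)) -> f =1 g.
Proof.
move=> fg; elim/tensor_ind => [|u v Hu Hv|x n]; last exact: fg.
  by rewrite !raddf0.
by rewrite !raddfB /= Hu Hv.
Qed.

Definition tensor_scale_bal (s : S^c) : balanced tensor.
Proof.
refine (@Balanced _ (fun x n => pure x (s *: n)) _ _ _).
- by move=> x y n; rewrite pureDl.
- by move=> x n p; rewrite scalerDr pureDr.
- by move=> x a n; rewrite pureZ lactZ.
Defined.

Definition tensor_scale (s : S^c) : tensor -> tensor :=
  tensor_lift (tensor_scale_bal s).
HB.instance Definition _ s := GRing.isZmodMorphism.Build tensor tensor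
  (tensor_scale s) (tensor_lift_zmod (tensor_scale_bal s)).

Lemma tensor_scaleE s x n : tensor_scale s (pure x n) = pure x (s *: n).
Proof. exact: tensor_liftE. Qed.

Lemma tensor_scaleA a b t :
  tensor_scale a (tensor_scale b t) = tensor_scale (a * b) t.
Proof.
elim/tensor_ind: t => [|u v Hu Hv|x n]; first by rewrite !raddf0.
  by rewrite !raddfB /= Hu Hv.
by rewrite !tensor_scaleE scalerA.
Qed.

Lemma tensor_scale1 : left_id 1 tensor_scale.
Proof.
elim/tensor_ind => [|u v Hu Hv|x n]; first by rewrite !raddf0.
  by rewrite !raddfB /= Hu Hv.
by rewrite !tensor_scaleE scale1r.
Qed.

Lemma tensor_scaleDr : right_distributive tensor_scale +%R.
Proof. by move=> a u v; rewrite raddfD. Qed.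

Lemma tensor_scaleDl t : {morph tensor_scale^~ t : a b / a + b}.
Proof.
move=> a b; elim/tensor_ind: t => [|u v Hu Hv|x n].
- by rewrite !raddf0 addr0.
- by rewrite !raddfB /= Hu Hv opprD addrACA.
- by rewrite !tensor_scaleE scalerDl pureDr.
Qed.

HB.instance Definition _ := GRing.Zmodule_isLmodule.Build S^c tensor
  tensor_scaleA tensor_scale1 tensor_scaleDr tensor_scaleDl.

Lemma scale_pure (s : S^c) x n : s *: pure x n = pure x (s *: n).
Proof. exact: tensor_scaleE. Qed.

End TensorGroup.

Section TensorMap.
Variables (K S : pzRingType) (M M' : lmodType K^c) (f : {linear M -> M'}).
Variable N : bimodule K S.

Definition tensor_map_bal : balanced M N (tensor M' N).
Proof.
refine (@Balanced _ _ M N _ (fun x n => pure (f x) n) _ _ _).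
- by move=> x y n; rewrite raddfD pureDl.
- by move=> x n p; rewrite pureDr.
- by move=> x a n; rewrite linearZ pureZ.
Defined.

Definition tensor_map : tensor M N -> tensor M' N := tensor_lift tensor_map_bal.

Lemma tensor_mapE x n : tensor_map (pure x n) = pure (f x) n.
Proof. exact: tensor_liftE. Qed.

Lemma tensor_map_zmod : zmod_morphism tensor_map.
Proof. exact: tensor_lift_zmod. Qed.

HB.instance Definition _ := GRing.isZmodMorphism.Build
  (tensor M N) (tensor M' N) tensor_map tensor_map_zmod.

Lemma tensor_map_scalable : scalable tensor_map.
Proof.
move=> s; elim/tensor_ind => [|u v Hu Hv|x n].
- by rewrite !(scaler0, raddf0).
- by rewrite scalerBr !raddfB /= Hu Hv.
- by rewrite scale_pure !tensor_mapE scale_pure.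
Qed.

HB.instance Definition _ := GRing.isScalable.Build
  S^c (tensor M N) (tensor M' N) *:%R tensor_map tensor_map_scalable.

End TensorMap.
Arguments tensor_map {K S M M'} f N.

Definition ring_bimodule (K S : pzRingType) (f : {rmorphism K -> S}) :
  bimodule K S.
Proof.
refine (@Bimodule K S (S^c)^o (fun a x => (f a * (x : S) : S)) _ _ _ _ _).
- by move=> a b x; rewrite mulrA rmorphM.
- by move=> x; rewrite rmorph1 mul1r.
- by move=> a b x; rewrite rmorphD mulrDl.
- by move=> a x y; rewrite mulrDr.
- by move=> a s x; rewrite -[s *: x]/((x : S) * (s : S)) mulrA.
Defined.

Record complex (K : pzRingType) := Complex {
  cobj :> int -> lmodType K^c;
  cdiff : forall k : int, {linear cobj (k + 1) -> cobj k};
  cdiffK : forall k x, cdiff k (cdiff (k + 1) x) = 0 }.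

Definition bounded (K : pzRingType) (C : complex K) : Prop :=
  exists n : nat, forall k : int, (n < `|k|)%N -> forall x : C k, x = 0.

(* On columns, [a *: v] multiplies every entry of v by a on the right. *)
Definition fg_free (K : pzRingType) (M : lmodType K^c) : Prop :=
  exists n (f : {linear 'cV[K^c]_n -> M}), bijective f.

(* The equation d s + s d = id, in degree k + 1. *)
Definition contractible (K : pzRingType) (C : complex K) : Prop :=
  exists s : forall k : int, {linear C k -> C (k + 1)},
    forall (k : int) (x : C (k + 1)),
      cdiff C (k + 1) (s (k + 1) x) + s k (cdiff C k x) = x.

Definition tensor_complex (K S : pzRingType) (C : complex K)
  (N : bimodule K S) : complex S.
Proof.
refine (@Complex S (fun k => tensor (C k) N)
  (fun k => tensor_map (cdiff C k) N) _).
move=> k; elim/tensor_ind => [|u v Hu Hv|x n].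
- by rewrite !raddf0.
- by rewrite !raddfB /= Hu Hv subr0.
- rewrite /= !tensor_mapE cdiffK.
  by apply: (addrI (pure 0 n)); rewrite -pureDl !addr0.
Defined.

Definition base_change (K S : pzRingType) (C : complex K)
  (f : {rmorphism K -> S}) : complex S := tensor_complex C (ring_bimodule f).

Record chain_map (K : pzRingType) (C D : complex K) := ChainMap {
  cmap :> forall k : int, {linear C k -> D k};
  cmapC : forall k x, cmap k (cdiff C k x) = cdiff D k (cmap (k + 1) x) }.

(* Homology is taken in degree k + 1, as k ranges over all integers, so that
   no transport along k - 1 + 1 = k is needed.  It is only given the structure
   of an abelian group: this is enough to say that a map is invertible. *)
Section Homology.
Variables (K : pzRingType) (C : complex K) (k : int).

Definition cycleb : {pred C (k + 1)} := fun x => cdiff C k x == 0.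

Lemma cycle_closed : zmod_closed cycleb.
Proof.
split; rewrite ?unfold_in /cycleb ?raddf0 // => x y.
by rewrite !unfold_in => /eqP x0 /eqP y0; rewrite raddfB /= x0 y0 subr0.
Qed.

HB.instance Definition _ :=
  GRing.isZmodClosed.Build (C (k + 1)) cycleb cycle_closed.

Record cycle := Cycle { cycle_val :> C (k + 1); _ : cycle_val \in cycleb }.
HB.instance Definition _ := [isSub for cycle_val].
HB.instance Definition _ := [Choice of cycle by <:].
HB.instance Definition _ := [SubChoice_isSubZmodule of cycle by <:].

Definition boundaryb : {pred cycle} :=
  fun z => `[< exists y, val z = cdiff C (k + 1) y >].

Lemma boundary_closed : zmod_closed boundaryb.
Proof.
split; first by apply/asboolP; exists 0; rewrite !raddf0.
move=> u v /asboolP[x Hx] /asboolP[y Hy]; apply/asboolP; exists (x - y).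
by rewrite raddfB /= Hx Hy raddfB.
Qed.

HB.instance Definition _ :=
  GRing.isZmodClosed.Build cycle boundaryb boundary_closed.

Definition homology := Quotient.quot boundaryb.
HB.instance Definition _ := GRing.Zmodule.on homology.
HB.instance Definition _ := Quotient.on homology.

End Homology.
Arguments cycleb {K} C k.
Arguments boundaryb {K} C k.

Section HomologyMap.
Variables (K : pzRingType) (C D : complex K) (f : chain_map C D) (k : int).

Lemma cycle_map_subproof (z : cycle C k) : f (k + 1) (val z) \in cycleb D k.
Proof.
rewrite unfold_in /cycleb -cmapC.
by have /eqP -> := valP z; rewrite raddf0.
Qed.

Definition cycle_map (z : cycle C k) : cycle D k := Cycle (cycle_map_subproof z).

Definition homology_map (h : homology C k) : homology D k :=
  \pi_(homology D k) (cycle_map (repr h)).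

Lemma homology_map_pi z :
  homology_map (\pi_(homology C k) z) = \pi_(homology D k) (cycle_map z).
Proof.
apply/eqP; rewrite -Quotient.idealrBE; apply/asboolP.
have : repr (\pi_(homology C k) z) - z \in boundaryb C k.
  by rewrite Quotient.idealrBE reprK.
move=> /asboolP[y Hy]; exists (f _ y).
by rewrite -cmapC -Hy /= -raddfB.
Qed.

End HomologyMap.
Arguments homology_map {K C D} f k.

Definition quasi_iso (K : pzRingType) (C D : complex K) (f : chain_map C D) :=
  forall k : int, bijective (homology_map f k).

Definition hom_class (K : pzRingType) :=
  forall M N : lmodType K^c, {linear M -> N} -> Prop.

Definition inverting (K : pzRingType) (Sigma : hom_class K) (S : pzRingType)
    (f : {rmorphism K -> S}) : Prop :=
  forall (M N : lmodType K^c) (s : {linear M -> N}), Sigma M N s ->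
    bijective (tensor_map s (ring_bimodule f)).

Definition is_localisation (K : pzRingType) (Sigma : hom_class K)
    (L : pzRingType) (lambda : {rmorphism K -> L}) : Prop :=
  inverting Sigma lambda /\
  forall (S : pzRingType) (f : {rmorphism K -> S}), inverting Sigma f ->
    exists2 g : {rmorphism L -> S}, g \o lambda =1 f &
      forall h : {rmorphism L -> S}, h \o lambda =1 f -> h =1 g.

(* P is the internal direct sum of the additive subgroups [gpart k].  That 1
   lies in [gpart 0] is a consequence, see [gcomp1_mem]. *)
Record grading (P : pzRingType) := Grading {
  gpart :> nat -> zmodClosed P;
  gpartM : forall k l x y,
    x \in gpart k -> y \in gpart l -> x * y \in gpart (k + l)%N;
  gpart_sum : forall x, exists n, exists2 c : nat -> P,
    (forall k, c k \in gpart k) & x = \sum_(k < n) c k;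
  gpart_indep : forall n (c : nat -> P), (forall k, c k \in gpart k) ->
    \sum_(k < n) c k = 0 -> forall k, (k < n)%N -> c k = 0 }.

Section Grading.
Variables (P : pzRingType) (R : grading P).

Lemma gcomp_ex x : exists c : nat -> P, (forall k, c k \in R k) /\
  exists n, (forall k, (n <= k)%N -> c k = 0) /\ x = \sum_(k < n) c k.
Proof.
have [n [c Rc ->]] := gpart_sum R x.
exists (fun k => if (k < n)%N then c k else 0); split.
  by move=> k; case: ifP => // _; exact: rpred0.
exists n; split=> [k|]; first by rewrite ltnNge => ->.
by apply: eq_bigr => i _; rewrite ltn_ord.
Qed.

Definition gcomp (x : P) : nat -> P := projT1 (cid (gcomp_ex x)).

Lemma gcomp_mem x k : gcomp x k \in R k.
Proof. by rewrite /gcomp; case: cid => c /= []. Qed.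

Lemma gcomp_sum x : exists n, (forall k, (n <= k)%N -> gcomp x k = 0) /\
  x = \sum_(k < n) gcomp x k.
Proof. by rewrite /gcomp; case: cid => c /= []. Qed.

Lemma sum_widen (c : nat -> P) n N : (n <= N)%N ->
  (forall k, (n <= k)%N -> c k = 0) -> \sum_(k < N) c k = \sum_(k < n) c k.
Proof.
move=> nN c0; rewrite (big_ord_widen N c nN) [RHS]big_mkcond /=.
by apply: eq_bigr => i _; case: ltnP => // /c0.
Qed.

Lemma gcomp_uniq x (c : nat -> P) n : (forall k, c k \in R k) ->
  (forall k, (n <= k)%N -> c k = 0) -> x = \sum_(k < n) c k -> gcomp x =1 c.
Proof.
move=> Rc c0 xE k; have [m [g0 xE']] := gcomp_sum x.
set N := maxn k.+1 (maxn n m).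
have: \sum_(i < N) (gcomp x i - c i) = 0.
  have mN : (m <= N)%N by rewrite /N !leq_max leqnn !orbT.
  have nN : (n <= N)%N by rewrite /N !leq_max leqnn !orbT.
  by rewrite sumrB (sum_widen mN g0) (sum_widen nN c0) -xE -xE' subrr.
move/(@gpart_indep _ R _ (fun i => gcomp x i - c i)) => H; apply/eqP.
rewrite -subr_eq0; apply/eqP/H => [i|]; first by rewrite rpredB ?gcomp_mem ?Rc.
by rewrite leq_max leqnn.
Qed.

Lemma gcomp_zmod k : zmod_morphism (gcomp^~ k).
Proof.
move=> x y; have [m [x0 xE]] := gcomp_sum x; have [n [y0 yE]] := gcomp_sum y.
apply: (@gcomp_uniq _ (fun k => gcomp x k - gcomp y k) (maxn m n)) => [i|i|].
- by rewrite rpredB ?gcomp_mem.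
- by rewrite geq_max => /andP[/x0 -> /y0 ->]; rewrite subr0.
- rewrite sumrB (sum_widen (leq_maxl m n) x0) (sum_widen (leq_maxr m n) y0).
  by rewrite -xE -yE.
Qed.

Definition gproj k x := gcomp x k.
HB.instance Definition _ k :=
  GRing.isZmodMorphism.Build P P (gproj k) (gcomp_zmod k).

Lemma gcomp0 k : gcomp 0 k = 0.
Proof. exact: (raddf0 (gproj k)). Qed.

Lemma gcompD x y k : gcomp (x + y) k = gcomp x k + gcomp y k.
Proof. exact: (raddfD (gproj k)). Qed.

Lemma gcomp_bigsum n (F : 'I_n -> P) k :
  gcomp (\sum_(i < n) F i) k = \sum_(i < n) gcomp (F i) k.
Proof. exact: (raddf_sum (gproj k)). Qed.

Lemma gcomp_hom x l : x \in R l -> forall k, gcomp x k = if k == l then x else 0.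
Proof.
move=> Rx; apply: (@gcomp_uniq _ (fun k => if k == l then x else 0) l.+1).
- by move=> k; case: eqP => [->|]; rewrite ?rpred0.
- by move=> k; case: eqP => [->|//]; rewrite ltnn.
- by rewrite -big_mkcond /= (big_pred1 (Ordinal (ltnSn l))) // => i; rewrite -val_eqE.
Qed.

Lemma gcompM x y n :
  gcomp (x * y) n = \sum_(i < n.+1) gcomp x i * gcomp y (n - i).
Proof.
have [p [x0 xE]] := gcomp_sum x; have [q [y0 yE]] := gcomp_sum y.
set N := maxn n.+1 (maxn p q).
have nN : (n.+1 <= N)%N by rewrite leq_max leqnn.
rewrite {1}xE {1}yE -(@sum_widen _ p N) ?leq_max ?leqnn ?orbT //.
rewrite -(@sum_widen _ q N) ?leq_max ?leqnn ?orbT //.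
rewrite mulr_suml gcomp_bigsum /=.
rewrite (big_ord_widen N (fun i => gcomp x i * gcomp y (n - i)) nN).
rewrite [RHS]big_mkcond /=; apply: eq_bigr => i _.
rewrite mulr_sumr gcomp_bigsum /=.
transitivity (\sum_(j < N) if n == (i + j)%N then gcomp x i * gcomp y j else 0).
  by apply: eq_bigr => j _; apply: gcomp_hom; apply: gpartM; exact: gcomp_mem.
rewrite -big_mkcond /=; case: ltnP => [lin|lni].
  have ljN : (n - i < N)%N by rewrite (leq_trans _ nN) // ltnS leq_subr.
  rewrite (big_pred1 (Ordinal ljN)) // => j /=.
  rewrite eq_sym -[RHS]/(val j == n - i)%N -[RHS](eqn_add2l i) subnKC //.
by rewrite big_pred0 // => j; rewrite ltn_eqF // ltn_addr.
Qed.

Lemma gcomp1_mem : 1 \in R 0.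
Proof.
set e := gcomp 1 0.
have He l x : x \in R l -> x * e = x.
  move=> Rx; have := gcomp_hom Rx l; rewrite eqxx -{1}[x]mulr1 gcompM.
  rewrite (bigD1 ord_max) //= subnn (gcomp_hom Rx) eqxx big1 ?addr0 // => i.
  by rewrite -val_eqE /= => /negPf ni; rewrite (gcomp_hom Rx) ni mul0r.
suff -> : 1 = e by exact: gcomp_mem.
have [n [_ E]] := gcomp_sum 1.
rewrite -[e]mul1r {2}E mulr_suml {1}E; apply: eq_bigr => i _.
by rewrite (He i) // gcomp_mem.
Qed.

Definition deg0b : {pred P} := fun x => x \in R 0%N.

Lemma deg0_closed : subring_closed deg0b.
Proof.
split; first exact: gcomp1_mem.
  by move=> x y Hx Hy; exact: rpredB.
by move=> x y Hx Hy; exact: (gpartM (k := 0) (l := 0)).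
Qed.

HB.instance Definition _ := GRing.isSubringClosed.Build P deg0b deg0_closed.

Record deg0 := Deg0 { deg0_val :> P; _ : deg0_val \in deg0b }.
HB.instance Definition _ := [isSub for deg0_val].
HB.instance Definition _ := [Choice of deg0 by <:].
HB.instance Definition _ :=
  GRing.SubChoice_isSubPzRing.Build P deg0b deg0 deg0_closed.

Definition tr0 (x : P) : deg0 := @Deg0 (gcomp x 0) (gcomp_mem x 0).

Lemma tr0_zmod : zmod_morphism tr0.
Proof. by move=> x y; apply: val_inj; rewrite /= gcomp_zmod. Qed.

Lemma tr0_monoid : monoid_morphism tr0.
Proof.
split; first by apply: val_inj; rewrite /= (gcomp_hom gcomp1_mem).
by move=> x y; apply: val_inj; rewrite /= gcompM big_ord_recl big_ord0 addr0.
Qed.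

HB.instance Definition _ := GRing.isZmodMorphism.Build P deg0 tr0 tr0_zmod.
HB.instance Definition _ := GRing.isMonoidMorphism.Build P deg0 tr0 tr0_monoid.

(* [pcoef u k] is the coefficient r_k of t^k; it has to lie in R_k. *)
Record pseries := PSeries {
  pcoef : nat -> P;
  pcoef_subproof : `[< forall k, pcoef k \in R k >] }.
HB.instance Definition _ := [isSub for pcoef].
HB.instance Definition _ := [Choice of pseries by <:].

Lemma pcoef_mem (u : pseries) k : pcoef u k \in R k.
Proof. by have /asboolP := pcoef_subproof u. Qed.

Definition mk_pseries (c : nat -> P) (Rc : forall k, c k \in R k) : pseries :=
  PSeries (asboolT Rc).

Lemma pseriesP (u v : pseries) : pcoef u =1 pcoef v -> u = v.
Proof. by move=> uv; apply: val_inj; apply/funext. Qed.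

Definition ps0 := mk_pseries (fun k => rpred0 (R k)).
Definition psN (u : pseries) : pseries :=
  @mk_pseries (fun k => - pcoef u k) (fun k => rpredNr (pcoef_mem u k)).
Definition psD (u v : pseries) : pseries :=
  @mk_pseries (fun k => pcoef u k + pcoef v k)
    (fun k => rpredD (pcoef_mem u k) (pcoef_mem v k)).

Lemma ps1_subproof k : (if k is 0%N then 1 else 0) \in R k.
Proof. by case: k => [|k]; [exact: gcomp1_mem | exact: rpred0]. Qed.
Definition ps1 : pseries :=
  @mk_pseries (fun k => if k is 0%N then 1 else 0) ps1_subproof.

Lemma psM_subproof (u v : pseries) k :
  \sum_(i < k.+1) pcoef u i * pcoef v (k - i) \in R k.
Proof.
apply: rpred_sum => i _; have le_ik : (i <= k)%N by rewrite -ltnS.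
by rewrite -[X in R X](subnKC le_ik); apply: gpartM; exact: pcoef_mem.
Qed.
Definition psM (u v : pseries) : pseries :=
  @mk_pseries (fun k => \sum_(i < k.+1) pcoef u i * pcoef v (k - i))
    (psM_subproof u v).

Lemma psDA : associative psD.
Proof. by move=> u v w; apply: pseriesP => k /=; rewrite addrA. Qed.
Lemma psDC : commutative psD.
Proof. by move=> u v; apply: pseriesP => k /=; rewrite addrC. Qed.
Lemma ps0D : left_id ps0 psD.
Proof. by move=> u; apply: pseriesP => k /=; rewrite add0r. Qed.
Lemma psND : left_inverse ps0 psN psD.
Proof. by move=> u; apply: pseriesP => k /=; rewrite addNr. Qed.

Lemma psME (u v : pseries) k :
  pcoef (psM u v) k = \sum_(i < k.+1) pcoef u i * pcoef v (k - i).
Proof. by []. Qed.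

Lemma psM_rev (u v : pseries) k :
  pcoef (psM u v) k = \sum_(i < k.+1) pcoef u (k - i) * pcoef v i.
Proof.
rewrite /= (reindex_inj rev_ord_inj) /=.
by apply: eq_bigr => j _; rewrite (sub_ordK j).
Qed.

Lemma psMA : associative psM.
Proof.
move=> u v w; apply: pseriesP => i; rewrite psME [RHS]psM_rev.
pose coef3 j k := pcoef u j * (pcoef v (i - j - k)%N * pcoef w k).
transitivity (\sum_(j < i.+1) \sum_(k < i.+1 | (k <= i - j)%N) coef3 j k).
  apply: eq_bigr => j _; rewrite psM_rev mulr_sumr /=.
  by rewrite (big_ord_narrow_leq (leq_subr _ _)).
rewrite (exchange_big_dep predT) //=; apply: eq_bigr => k _.
transitivity (\sum_(j < i.+1 | (j <= i - k)%N) coef3 j k).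
  apply: eq_bigl => j; rewrite -ltnS -(ltnS j) -!subSn ?leq_ord //.
  by rewrite -subn_gt0 -(subn_gt0 j) -!subnDA addnC.
rewrite (big_ord_narrow_leq (leq_subr _ _)) mulr_suml /=.
by apply: eq_bigr => j _; rewrite /coef3 -!subnDA addnC mulrA.
Qed.

Lemma ps1M : left_id ps1 psM.
Proof.
move=> u; apply: pseriesP => k /=; rewrite big_ord_recl /= mul1r subn0.
by rewrite big1 ?addr0 // => i _; rewrite mul0r.
Qed.

Lemma psM1 : right_id ps1 psM.
Proof.
move=> u; apply: pseriesP => k; rewrite psM_rev big_ord_recl /= mulr1 subn0.
by rewrite big1 ?addr0 // => i _; rewrite mulr0.
Qed.

Lemma psMDl : left_distributive psM psD.
Proof.
move=> u v w; apply: pseriesP => k /=; rewrite -big_split /=.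
by apply: eq_bigr => i _; rewrite mulrDl.
Qed.

Lemma psMDr : right_distributive psM psD.
Proof.
move=> u v w; apply: pseriesP => k /=; rewrite -big_split /=.
by apply: eq_bigr => i _; rewrite mulrDr.
Qed.

HB.instance Definition _ := GRing.isPzRing.Build pseries
  psDA psDC ps0D psND psMA ps1M psM1 psMDl psMDr.

Definition to_pseries (x : P) : pseries :=
  @mk_pseries (gcomp x) (gcomp_mem x).

Lemma to_pseries_zmod : zmod_morphism to_pseries.
Proof. by move=> x y; apply: pseriesP => k; exact: gcomp_zmod. Qed.

Lemma to_pseries_monoid : monoid_morphism to_pseries.
Proof.
split=> [|x y]; apply: pseriesP => k; last exact: gcompM.
by rewrite /= (gcomp_hom gcomp1_mem); case: k.
Qed.

HB.instance Definition _ :=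
  GRing.isZmodMorphism.Build P pseries to_pseries to_pseries_zmod.
HB.instance Definition _ :=
  GRing.isMonoidMorphism.Build P pseries to_pseries to_pseries_monoid.

(* P_{>=1} consists of the elements without component of degree 0; (P^c)^o is
   P as a right module over itself. *)
Definition pge1b : {pred (P^c)^o} := fun x => gcomp x 0 == 0.

Lemma pge1_closed : submod_closed pge1b.
Proof.
split; first by rewrite unfold_in /pge1b gcomp0.
move=> a x y; rewrite !unfold_in /pge1b => /eqP x0 /eqP y0.
rewrite gcompD y0 addr0 -[a *: x]/((x : P) * (a : P)).
by rewrite gcompM big_ord_recl big_ord0 x0 mul0r addr0.
Qed.

HB.instance Definition _ :=
  GRing.isSubmodClosed.Build P^c (P^c)^o pge1b pge1_closed.

Record pge1 := PGe1 { pge1_val :> (P^c)^o; _ : pge1_val \in pge1b }.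
HB.instance Definition _ := [isSub for pge1_val].
HB.instance Definition _ := [Choice of pge1 by <:].
HB.instance Definition _ := [SubChoice_isSubLmodule of pge1 by <:].

Lemma pge1_lact_subproof (a : P) (x : pge1) :
  (a * (pge1_val x : P) : P) \in pge1b.
Proof.
have /eqP x0 := valP x.
by rewrite unfold_in /pge1b gcompM big_ord_recl big_ord0 x0 mulr0 addr0.
Qed.

Definition pge1_bimodule : bimodule P P.
Proof.
refine (@Bimodule P P pge1 (fun a x => PGe1 (pge1_lact_subproof a x)) _ _ _ _ _).
- by move=> a b x; apply: val_inj; rewrite /= mulrA.
- by move=> x; apply: val_inj; rewrite /= mul1r.
- by move=> a b x; apply: val_inj; rewrite /= mulrDl.
- by move=> a x y; apply: val_inj; rewrite /= mulrDr.
- by move=> a s x; apply: val_inj; rewrite /= -[s *: _]/((_ : P) * (s : P)) mulrA.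
Defined.

Definition zeta_bal (M : lmodType P^c) : balanced M pge1_bimodule M.
Proof.
refine (@Balanced _ _ M pge1_bimodule M (fun c x => (pge1_val x : P^c) *: c) _ _ _).
- by move=> x y n; rewrite scalerDr.
- by move=> x n p; rewrite /= scalerDl.
- by move=> x a n; rewrite /= scalerA.
Defined.

Definition zeta_fun (M : lmodType P^c) : tensor M pge1_bimodule -> M :=
  tensor_lift (zeta_bal M).

Lemma zetaE (M : lmodType P^c) (c : M) (x : pge1) :
  zeta_fun (pure (N := pge1_bimodule) c x) = (pge1_val x : P^c) *: c.
Proof. exact: tensor_liftE. Qed.

Section ZetaLinear.
Variable M : lmodType P^c.

Lemma zeta_fun_zmod : zmod_morphism (@zeta_fun M).
Proof. exact: tensor_lift_zmod. Qed.

HB.instance Definition _ := GRing.isZmodMorphism.Build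
  (tensor M pge1_bimodule) M (@zeta_fun M) zeta_fun_zmod.

Lemma zeta_fun_scalable : scalable (@zeta_fun M).
Proof.
move=> s; elim/tensor_ind => [|u v Hu Hv|x n].
- by rewrite !(scaler0, raddf0).
- by rewrite scalerBr !raddfB /= Hu Hv.
- by rewrite scale_pure !zetaE /= scalerA.
Qed.

HB.instance Definition _ := GRing.isScalable.Build
  P^c (tensor M pge1_bimodule) M *:%R (@zeta_fun M) zeta_fun_scalable.

End ZetaLinear.

Definition zeta (C : complex P) : chain_map (tensor_complex C pge1_bimodule) C.
Proof.
refine (@ChainMap P (tensor_complex C pge1_bimodule) C
  (fun k => @zeta_fun (C k)) _).
move=> k; elim/tensor_ind => [|u v Hu Hv|x n].
- by rewrite !raddf0.
- by rewrite !raddfB /= Hu Hv.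
- by rewrite /= tensor_mapE !zetaE linearZ.
Defined.

End Grading.

(* Matrices act on columns from the left, with products taken in K, so that
   [mx_hom] is linear for the right K-module structure. *)
Section MatrixHom.
Variables (K : pzRingType) (n : nat) (A : 'M[K]_n).

Definition mx_hom (v : 'cV[K^c]_n) : 'cV[K^c]_n := A *m (v : 'cV[K]_n).

Lemma mx_hom_linear : linear mx_hom.
Proof.
move=> a u v; apply/matrixP => i j; rewrite !mxE.
rewrite -[a * _]/((_ : K) * (a : K)) mulr_suml -big_split /=.
apply: eq_bigr => k _; rewrite !mxE -[a * _]/((_ : K) * (a : K)).
by rewrite -mulrA /= mulrDr.
Qed.

HB.instance Definition _ := GRing.isLinear.Build
  K^c 'cV[K^c]_n 'cV[K^c]_n *:%R mx_hom mx_hom_linear.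

Definition invertible_mx : Prop :=
  exists B : 'M[K]_n, A *m B = 1%:M /\ B *m A = 1%:M.

End MatrixHom.

Inductive omega_plus (P : pzRingType) (R : grading P) : hom_class P :=
| OmegaPlus n (A : 'M[P]_n) :
    invertible_mx (map_mx (tr0 R) A) -> omega_plus R (mx_hom A).

(* Main.v *)
(* Write M0 for M (x)_P R_0, where red : M -> M0 is reduction through tr0.

   A contraction of C (x) R_0 lifts, by freeness, to P-linear maps s on C such
   that phi = ds + sd reduces to the identity over R_0.  In a basis phi is then a
   matrix of omega_plus, so over every omega_plus-inverting ring S the map
   phi^-1 s is a contraction of C (x) S.  This covers the localisation and the
   power series ring, where a matrix with invertible constant term is inverted by
   a geometric series.  Conversely tr0 factors through both rings, so
   contractions over them induce contractions over R_0.

   As zeta is injective with image the kernel of red : C -> C (x) R_0, it is a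
   quasi-isomorphism exactly when C (x) R_0 is acyclic; for a bounded complex of
   free modules this yields a contraction, built by induction on the degree. *)
From HB Require Import structures.
Require Import Defs.
From mathcomp Require Import all_boot all_algebra.
From mathcomp Require Import generic_quotient ring_quotient boolp zify.

Set Implicit Arguments.
Unset Strict Implicit.
Unset Printing Implicit Defensive.

Import GRing.Theory.
Local Open Scope ring_scope.
Local Open Scope quotient_scope.

(** Choice in dependent form: the homotopies below live in modules that vary with the degree. *)
Lemma dep_choice (I : Type) (T : I -> Type) (Q : forall i, T i -> Prop) :
  (forall i, exists x, Q i x) -> exists f : forall i, T i, forall i, Q i (f i).
Proof.
by move=> H; exists (fun i => projT1 (cid (H i))) => i; exact: (projT2 (cid (H i))).
Qed.

(** * Sums and induced maps on tensor products *)

Section Pure.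
Variables (K S : pzRingType) (M : lmodType K^c) (N : bimodule K S).

Lemma pure0l (n : N) : pure (0 : M) n = 0.
Proof. by apply: (addrI (pure 0 n)); rewrite -pureDl !addr0. Qed.

Lemma pure0r (x : M) : pure x (0 : N) = 0.
Proof. by apply: (addrI (pure x 0)); rewrite -pureDr !addr0. Qed.

Lemma pure_suml I (r : seq I) (F : I -> M) (n : N) :
  pure (\sum_(i <- r) F i) n = \sum_(i <- r) pure (F i) n.
Proof. by apply: (big_morph (fun x => pure x n)) => [x y|]; rewrite ?pureDl ?pure0l. Qed.

Lemma pure_sumr I (r : seq I) (x : M) (F : I -> N) :
  pure x (\sum_(i <- r) F i) = \sum_(i <- r) pure x (F i).
Proof. by apply: (big_morph (fun n => pure x n)) => [n p|]; rewrite ?pureDr ?pure0r. Qed.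

End Pure.

Section TensorLinear.
Variables (K S : pzRingType) (M : lmodType K^c) (N : bimodule K S).
Variables (A : lmodType S^c) (f : balanced M N A).
Hypothesis fZ : forall (s : S^c) x n, f x (s *: n) = s *: f x n.

Lemma tensor_lift_linear : exists g : {linear tensor M N -> A},
  forall x n, g (pure x n) = f x n.
Proof.
have fS : scalable (tensor_lift f).
  move=> s; elim/tensor_ind => [|u v Hu Hv|x n].
  - by rewrite !(scaler0, raddf0).
  - by rewrite scalerBr !raddfB /= Hu Hv.
  - by rewrite scale_pure !tensor_liftE fZ.
pose g : {linear tensor M N -> A} := HB.pack (tensor_lift f)
  (GRing.isZmodMorphism.Build _ _ (tensor_lift f) (tensor_lift_zmod f))
  (GRing.isScalable.Build _ _ _ _ (tensor_lift f) fS).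
by exists g => x n; exact: tensor_liftE.
Qed.

End TensorLinear.

Lemma tensor_map_comp (K S : pzRingType) (M1 M2 M3 : lmodType K^c)
    (N : bimodule K S) (f : {linear M1 -> M2}) (g : {linear M2 -> M3})
    (h : {linear M1 -> M3}) : (forall x, h x = g (f x)) ->
  forall t, tensor_map h N t = tensor_map g N (tensor_map f N t).
Proof.
move=> hE; elim/tensor_ind => [|u v Hu Hv|x n]; first by rewrite !raddf0.
  by rewrite !raddfB /= Hu Hv.
by rewrite !tensor_mapE hE.
Qed.

Lemma tensor_map_id (K S : pzRingType) (M : lmodType K^c)
    (N : bimodule K S) (f : {linear M -> M}) : (forall x, f x = x) ->
  forall t, tensor_map f N t = t.
Proof.
move=> fE; elim/tensor_ind => [|u v Hu Hv|x n]; first by rewrite !raddf0.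
  by rewrite !raddfB /= Hu Hv.
by rewrite !tensor_mapE fE.
Qed.

(** * Bases, coordinate functionals and lifting for free modules *)

Definition dual_bases (K : pzRingType) (M : lmodType K^c) n
    (e : 'I_n -> M) (c : 'I_n -> {linear M -> (K^c)^o}) : Prop :=
  (forall x, x = \sum_i (c i x : K^c) *: e i) /\
  (forall i j, c i (e j) = (i == j)%:R).

Lemma dual_bases_ex (K : pzRingType) (M : lmodType K^c) : fg_free M ->
  exists n e c, @dual_bases K M n e c.
Proof.
move=> [n [f [g fK gK]]].
have gL := can2_linear fK gK.
pose co i (x : M) : (K^c)^o := g x i 0.
have coL i : linear (co i) by move=> a x y; rewrite /co gL !mxE.
exists n, (fun i => f (delta_mx i 0)).
pose c i : {linear M -> (K^c)^o} := HB.pack (co i)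
  (GRing.isLinear.Build _ _ _ _ (co i) (coL i)).
exists c.
split=> [x|i j] /=; last by rewrite /co fK mxE eqxx andbT.
rewrite -[LHS]gK [g x in LHS](matrix_sum_delta (g x)) linear_sum /=.
by apply: eq_bigr => i _; rewrite big_ord1 linearZ.
Qed.

Section DualBases.
Variables (K : pzRingType) (M : lmodType K^c) (n : nat).
Variables (e : 'I_n -> M) (c : 'I_n -> {linear M -> (K^c)^o}).
Hypothesis ec : dual_bases e c.

Lemma coord_comb (a : 'I_n -> K^c) i : c i (\sum_j a j *: e j) = a i.
Proof.
rewrite linear_sum (bigD1 i) //= linearZ /= ec.2 eqxx big1 => [|j ji].
  by rewrite addr0 -[_ *: _]/(a i * 1) mulr1.
by rewrite linearZ /= ec.2 eq_sym (negPf ji) scaler0.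
Qed.

Lemma linear_comb (N : lmodType K^c) (y : 'I_n -> N) :
  exists f : {linear M -> N}, forall x, f x = \sum_i (c i x : K^c) *: y i.
Proof.
pose f x := \sum_i (c i x : K^c) *: y i.
have fL : linear f.
  move=> a x z; rewrite /f scaler_sumr -big_split /=; apply: eq_bigr => i _.
  by rewrite linearP scalerDl scalerA.
pose g : {linear M -> N} := HB.pack f (GRing.isLinear.Build _ _ _ _ f fL).
by exists g.
Qed.

End DualBases.

(* Stated for a linear relation G so that it covers both lifting along d and
   lifting through the semilinear surjection M -> M (x) R_0. *)
Lemma free_lift (K : pzRingType) (M N : lmodType K^c) (G : M -> N -> Prop) :
    fg_free M -> (forall x, exists y, G x y) -> G 0 0 ->
    (forall a x x' y y', G x y -> G x' y' -> G (a *: x + x') (a *: y + y')) ->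
  exists f : {linear M -> N}, forall x, G x (f x).
Proof.
move=> /dual_bases_ex [n [e [c ec]]] /choice [y Gy] G0 GL.
have [f fE] := linear_comb c (fun i => y (e i)).
exists f => x; rewrite fE {1}(ec.1 x).
by apply: (big_ind2 G) => // [x1 y1 x2 y2|i _];
  [have := GL 1 x1 x2 y1 y2; rewrite !scale1r
  |have := GL (c i x : K^c) (e i) 0 (y (e i)) 0; rewrite !addr0]; auto.
Qed.

(** * The map x -> x (x) 1 along a ring homomorphism *)

Section Reduction.
Variables (K S : pzRingType) (f : {rmorphism K -> S}).

Definition red (M : lmodType K^c) (x : M) : tensor M (ring_bimodule f) :=
  pure (N := ring_bimodule f) x (1 : S).

Lemma red_zmod (M : lmodType K^c) : zmod_morphism (@red M).
Proof.
move=> x y; apply: (addIr (red y)); rewrite subrK -[LHS]pureDl.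
by rewrite subrK.
Qed.
HB.instance Definition _ (M : lmodType K^c) :=
  GRing.isZmodMorphism.Build M (tensor M (ring_bimodule f)) (@red M)
    (@red_zmod M).

Lemma pure_red (M : lmodType K^c) (x : M) (s : S) :
  pure (N := ring_bimodule f) x s = (s : S^c) *: red x.
Proof. by rewrite scale_pure -[_ *: _]/((1 : S) * s) mul1r. Qed.

Lemma redZ (M : lmodType K^c) (a : K^c) (x : M) :
  red (a *: x) = (f a : S^c) *: red x.
Proof. by rewrite {1}/red pureZ /= mulr1 pure_red. Qed.

Lemma tensor_map_red (M N : lmodType K^c) (g : {linear M -> N}) x :
  tensor_map g (ring_bimodule f) (red x) = red (g x).
Proof. exact: tensor_mapE. Qed.

(** As x (x) s = (x (x) 1) s, the elements [red x] generate the S-module. *)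
Lemma tensor_redP (M : lmodType K^c) (A : lmodType S^c)
    (g h : {linear tensor M (ring_bimodule f) -> A}) :
  (forall x, g (red x) = h (red x)) -> g =1 h.
Proof.
move=> gh; apply: tensor_ext => x s.
suff E (k : {linear tensor M (ring_bimodule f) -> A}) :
  k (pure x s) = (s : S^c) *: k (red x) by apply: etrans (E g) _; rewrite gh -E.
by rewrite (pure_red x s) linearZ.
Qed.

Lemma red_surj : (forall s, exists a, f a = s) ->
  forall (M : lmodType K^c) (t : tensor M (ring_bimodule f)), exists x, t = red x.
Proof.
move=> fs M; elim/tensor_ind => [|u v [x ->] [y ->]|x s].
- by exists 0; rewrite raddf0.
- by exists (x - y); rewrite raddfB.
- have [a fa] := fs s; exists ((a : K^c) *: x).
  by rewrite redZ fa; exact: pure_red.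
Qed.

(** The assignment x (x) s -> f(c x) s is balanced, so f(c x) depends only on [red x]. *)
Lemma red_coord (M : lmodType K^c) (c : {linear M -> (K^c)^o}) (x : M) :
  red x = 0 -> f (c x) = 0.
Proof.
have b1 : forall x y (s : ring_bimodule f),
  f (c (x + y)) * (s : S) = f (c x) * (s : S) + f (c y) * (s : S) :> S.
  by move=> u v s; rewrite linearD rmorphD mulrDl.
have b2 : forall x (s t : ring_bimodule f),
  f (c x) * (s + t : S) = f (c x) * (s : S) + f (c x) * (t : S) :> S.
  by move=> u s t; rewrite mulrDr.
have b3 : forall x (a : K^c) (s : ring_bimodule f),
  f (c (a *: x)) * (s : S) = f (c x) * (lact (a : K) s : S) :> S.
  by move=> u a s; rewrite linearZ /= -[_ *: _]/((_ : K) * (a : K)) rmorphM mulrA.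
move=> x0; have := tensor_liftE (Balanced b1 b2 b3) x (1 : S).
by rewrite -/(red x) x0 raddf0 /= mulr1.
Qed.

End Reduction.

(** * Base change of free modules, matrices and contractions *)

Section ReductionFree.
Variables (K S : pzRingType) (f : {rmorphism K -> S}).

Lemma red_eq0 (M : lmodType K^c) n (e : 'I_n -> M) c (x : M) :
  dual_bases e c -> red f x = 0 <-> forall i, f (c i x) = 0.
Proof.
move=> ec; split=> [x0 i|cx0]; first exact: red_coord.
rewrite (ec.1 x) raddf_sum big1 // => i _.
by rewrite /= redZ cx0 scale0r.
Qed.

(** With B inverse to f(A), the inverse map sends v (x) s to the sum of e_i (x) (B f(v))_i s. Both
    composites are compared with the expansion of v (x) s in the standard basis. *)
Lemma invertible_mx_tensor n (A : 'M[K]_n) : invertible_mx (map_mx f A) ->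
  bijective (tensor_map (M := 'cV[K^c]_n) (M' := 'cV[K^c]_n) (mx_hom A)
    (ring_bimodule f)).
Proof.
move=> [B [AB BA]]; set N := ring_bimodule f.
pose e i : 'cV[K^c]_n := delta_mx i 0.
pose fv (v : 'cV[K^c]_n) : 'cV[S]_n := map_mx f (v : 'cV[K]_n).
have fvD v w : fv (v + w) = fv v + fv w by apply/matrixP=> i j; rewrite !mxE rmorphD.
have vE (v : 'cV[K^c]_n) : v = \sum_i (v i 0 : K^c) *: e i.
  rewrite {1}[v]matrix_sum_delta; apply: eq_bigr => i _; by rewrite big_ord1.
pose psi (v : 'cV[K^c]_n) (s : N) : tensor 'cV[K^c]_n N :=
  \sum_i pure (N := N) (e i) ((B *m fv v) i 0 * (s : S) : S).
have psiDl v w s : psi (v + w) s = psi v s + psi w s.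
  rewrite -big_split /=; apply: eq_bigr => i _.
  by rewrite fvD mulmxDr mxE mulrDl pureDr.
have psiDr v s t : psi v (s + t) = psi v s + psi v t.
  rewrite -big_split /=; apply: eq_bigr => i _.
  by rewrite -pureDr mulrDr.
have psiZ v (a : K^c) s : psi (a *: v) s = psi v (lact (a : K) s).
  apply: eq_bigr => i _; congr (pure _ _).
  rewrite /= mulrA; congr (_ * _); rewrite !mxE mulr_suml.
  apply: eq_bigr => j _; rewrite !mxE -mulrA; congr (_ * _).
  by rewrite -rmorphM.
pose Psi : {additive tensor 'cV[K^c]_n N -> tensor 'cV[K^c]_n N} :=
  tensor_lift (Balanced psiDl psiDr psiZ).
have PsiE v s : Psi (pure v s) = psi v s := tensor_liftE _ v s.
have fvA v : fv (mx_hom A v) = map_mx f A *m fv v by exact: map_mxM.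
have pureE (v : 'cV[K^c]_n) (s : N) : pure v s =
    \sum_i pure (N := N) (e i) (fv v i 0 * (s : S) : S).
  rewrite {1}[v]vE pure_suml; apply: eq_bigr => i _.
  by rewrite pureZ mxE.
exists Psi.
  elim/tensor_ind => [|u v Hu Hv|v s]; first by rewrite !raddf0.
    by rewrite !raddfB /= Hu Hv.
  by rewrite tensor_mapE PsiE /psi fvA mulmxA BA mul1mx -pureE.
elim/tensor_ind => [|u v Hu Hv|v s]; first by rewrite !raddf0.
  by rewrite !raddfB /= Hu Hv.
rewrite PsiE raddf_sum /= pureE.
have feE k i : fv (mx_hom A (e i)) k 0 = f (A k i).
  rewrite fvA mxE (bigD1 i) //= !mxE !eqxx rmorph1 mulr1 big1 ?addr0 // => j ji.
  by rewrite !mxE (negPf ji) rmorph0 mulr0.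
under eq_bigr do rewrite tensor_mapE pureE.
rewrite exchange_big /=; apply: eq_bigr => k _; rewrite -pure_sumr.
congr (pure _ _); transitivity ((map_mx f A *m (B *m fv v)) k 0 * (s : S)).
  rewrite [in RHS]mxE mulr_suml; apply: eq_bigr => i _; 
  by rewrite feE mulrA !mxE.
by rewrite mulmxA AB mul1mx.
Qed.

End ReductionFree.

(* A contraction sigma is transported to
   tau (x (x) t) = (1 (x) g)(sigma (x (x) 1)) t. *)
Lemma contractible_comp (K S T : pzRingType) (C : complex K)
    (f : {rmorphism K -> S}) (g : {rmorphism S -> T}) (h : {rmorphism K -> T}) :
  (forall a, g (f a) = h a) ->
  contractible (base_change C f) -> contractible (base_change C h).
Proof.
move=> gf [s sP].
have [gam gamE] : exists gam : forall M : lmodType K^c,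
    {additive tensor M (ring_bimodule f) -> tensor M (ring_bimodule h)},
    forall M x a, gam M (pure x a) = pure (N := ring_bimodule h) x (g a).
  have b1 (M : lmodType K^c) (x y : M) (a : ring_bimodule f) :
      pure (N := ring_bimodule h) (x + y) (g a : T) =
      pure (N := ring_bimodule h) x (g a : T) + pure (N := ring_bimodule h) y (g a : T).
    exact: pureDl.
  have b2 (M : lmodType K^c) (x : M) (a b : ring_bimodule f) :
      pure (N := ring_bimodule h) x (g (a + b) : T) =
      pure (N := ring_bimodule h) x (g a : T) + pure (N := ring_bimodule h) x (g b : T).
    by rewrite rmorphD; exact: pureDr.
  have b3 (M : lmodType K^c) (x : M) (k : K^c) (a : ring_bimodule f) :
      pure (N := ring_bimodule h) (k *: x) (g a : T) =
      pure (N := ring_bimodule h) x (g (lact (k : K) a) : T).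
    by rewrite pureZ /= rmorphM gf.
  exists (fun M => tensor_lift (Balanced (b1 M) (b2 M) (b3 M))) => M x a.
  exact: tensor_liftE.
have gamZ (M : lmodType K^c) (a : S^c) (t : tensor M (ring_bimodule f)) :
    gam M (a *: t) = (g a : T^c) *: gam M t.
  elim/tensor_ind: t => [|u v Hu Hv|x b].
  - by rewrite !(scaler0, raddf0).
  - by rewrite scalerBr !raddfB /= Hu Hv.
  - rewrite scale_pure !gamE scale_pure; congr (pure _ _).
    exact: (rmorphM g (b : S) (a : S)).
have gam_red (M : lmodType K^c) x : gam M (red f x) = red h x.
  by rewrite gamE rmorph1.
have gamN (M N : lmodType K^c) (d : {linear M -> N}) t :
    gam N (tensor_map d (ring_bimodule f) t) = tensor_map d (ring_bimodule h) (gam M t).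
  elim/tensor_ind: t => [|u v Hu Hv|x b]; first by rewrite !raddf0.
    by rewrite !raddfB /= Hu Hv.
  by rewrite !(tensor_mapE, gamE).
have /dep_choice [r rE] : forall k, exists r : {linear tensor (C k) (ring_bimodule h) ->
    tensor (C (k + 1)) (ring_bimodule h)},
    forall x, r (red h x) = gam _ (s k (red f x)).
  move=> k; pose b x (a : ring_bimodule h) :
    tensor (C (k + 1)) (ring_bimodule h) := (a : T^c) *: gam _ (s k (red f x)).
  have b1 x y a : b (x + y) a = b x a + b y a.
    by rewrite /b !raddfD.
  have b2 x a a' : b x (a + a') = b x a + b x a' by exact: scalerDl.
  have b3 x (c : K^c) a : b (c *: x) a = b x (lact (c : K) a).
    rewrite /b redZ linearZ gamZ scalerA; congr (_ *: _).
    by rewrite /= gf.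
  have [|r rE] := @tensor_lift_linear _ _ _ _ _ (Balanced b1 b2 b3).
    by move=> a x t; rewrite /= /b scalerA.
  by exists r => x; rewrite rE /= /b scale1r.
exists r => k.
pose d k := tensor_map (cdiff C k) (ring_bimodule h).
(* On elements [red h x] the contraction equation is the image under [gam] of the one for s at
   [red f x]. *)
apply: (@tensor_redP _ _ h (C (k + 1)) _ ((d (k + 1) \o r (k + 1)) \+ (r k \o d k))
          idfun) => x /=.
rewrite /d tensor_map_red !rE -gamN -(tensor_map_red f (cdiff C k)) -raddfD.
by rewrite -gam_red; congr (gam _ _); exact: sP.
Qed.

Lemma linear_inverse (K : pzRingType) (M N : lmodType K) (f : {linear M -> N}) :
  bijective f -> exists g : {linear N -> M}, cancel f g /\ cancel g f.
Proof.
move=> [g fK gK]; have gL := can2_linear fK gK.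
pose h : {linear N -> M} := HB.pack g (GRing.isLinear.Build _ _ _ _ g gL).
by exists h.
Qed.

(** * Bijectivity on homology in terms of cycles and boundaries *)

Lemma homology_eq (K : pzRingType) (C : complex K) k (z w : Defs.cycle C k) :
  \pi_(homology C k) z = \pi_(homology C k) w <->
  exists y, val z - val w = cdiff C (k + 1) y.
Proof.
split=> [/eqP|[y zw]].
  by rewrite -Quotient.idealrBE => /asboolP[y Hy]; exists y; rewrite -Hy raddfB.
by apply/eqP; rewrite -Quotient.idealrBE; apply/asboolP; exists y; rewrite raddfB.
Qed.

Lemma cycle_ex (K : pzRingType) (C : complex K) k (x : C (k + 1)) :
  cdiff C k x = 0 -> exists z : Defs.cycle C k, val z = x.
Proof.
by move=> x0; have cx : x \in cycleb C k by [apply/eqP]; exists (Cycle cx).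
Qed.

Section HomologyCriterion.
Variables (K : pzRingType) (C D : complex K) (f : chain_map C D) (k : int).

Lemma homology_map_inj : injective (homology_map f k) ->
  forall x y, cdiff C k x = 0 -> f (k + 1) x = cdiff D (k + 1) y ->
  exists x', x = cdiff C (k + 1) x'.
Proof.
move=> f_inj x y /cycle_ex [z <-] fz.
have /homology_eq [x' E] :
    \pi_(homology C k) z = \pi_(homology C k) (0 : Defs.cycle C k).
  apply: f_inj; rewrite !homology_map_pi; apply/homology_eq; exists y.
  rewrite /= -fz -raddfB; congr (f _ _); exact: subr0.
by exists x'; rewrite -E; exact: esym (subr0 _).
Qed.

Lemma homology_map_surj : (forall h', exists h, homology_map f k h = h') ->
  forall y, cdiff D k y = 0 ->
  exists x y', cdiff C k x = 0 /\ y = f (k + 1) x + cdiff D (k + 1) y'.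
Proof.
move=> f_surj y /cycle_ex [z <-]; have [h] := f_surj (\pi_(homology D k) z).
rewrite -[h]reprK homology_map_pi => /esym/homology_eq [y' E].
exists (val (repr h)), y'; split; last by rewrite -E [RHS]addrC subrK.
exact/eqP/(valP (repr h)).
Qed.

Lemma homology_map_bij :
  (forall x y, cdiff C k x = 0 -> f (k + 1) x = cdiff D (k + 1) y ->
    exists x', x = cdiff C (k + 1) x') ->
  (forall y, cdiff D k y = 0 ->
    exists x y', cdiff C k x = 0 /\ y = f (k + 1) x + cdiff D (k + 1) y') ->
  bijective (homology_map f k).
Proof.
move=> f_inj f_surj.
have inj : injective (homology_map f k).
  move=> h h'; rewrite -[h]reprK -[h']reprK !homology_map_pi => /homology_eq [y E].
  apply/homology_eq; apply: (f_inj _ y); last by rewrite raddfB -E.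
  rewrite raddfB /=.
  by rewrite (eqP (valP (repr h))) (eqP (valP (repr h'))) subrr.
have /dep_choice [g gK] : forall h', exists h, homology_map f k h = h'.
  move=> h'; have [x [y' [/cycle_ex [z <-] E]]] :=
    f_surj _ (eqP (valP (repr h'))).
  exists (\pi_(homology C k) z); rewrite homology_map_pi -[RHS]reprK.
  apply/homology_eq; exists (- y').
  by rewrite [val (repr h')]E /= opprD addrA subrr sub0r raddfN.
by exists g => // h; apply: inj; rewrite gK.
Qed.

End HomologyCriterion.

(** * Graded rings, power series and the map zeta *)

Section Graded.
Variables (P : pzRingType) (R : grading P).

(** The constant term map. It extends [tr0] to power series, so contractions over that ring descend
    to R_0. *)
Definition pcoef0 (u : pseries R) : deg0 R := Deg0 (pcoef_mem u 0%N).

Lemma pcoef0_zmod : zmod_morphism pcoef0.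
Proof. by move=> u v; apply: val_inj. Qed.

Lemma pcoef0_monoid : monoid_morphism pcoef0.
Proof.
by split=> [|u v]; apply: val_inj => //=; rewrite big_ord_recl big_ord0 addr0.
Qed.

HB.instance Definition _ :=
  GRing.isZmodMorphism.Build (pseries R) (deg0 R) pcoef0 pcoef0_zmod.
HB.instance Definition _ :=
  GRing.isMonoidMorphism.Build (pseries R) (deg0 R) pcoef0 pcoef0_monoid.

Lemma pcoef0_to_pseries a : pcoef0 (to_pseries R a) = tr0 R a.
Proof. exact: val_inj. Qed.

Lemma tr0_val (r : deg0 R) : tr0 R (val r) = r.
Proof. by apply: val_inj; rewrite /= (gcomp_hom (valP r)). Qed.

Lemma pcoef_sum I (r : seq I) (F : I -> pseries R) k :
  pcoef (\sum_(i <- r) F i) k = \sum_(i <- r) pcoef (F i) k.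
Proof. by apply: (big_morph (fun u : pseries R => pcoef u k)). Qed.

Section SeriesMatrix.
Variable n : nat.
Implicit Types Y Z : 'M[pseries R]_n.

(** The t-adic filtration on matrices: it is multiplicative by [vanishM] and separated by
    [vanish_eq0]. *)
Definition vanish m Y := forall i j k, (k < m)%N -> pcoef (Y i j) k = 0.

Lemma vanishD m Y Z : vanish m Y -> vanish m Z -> vanish m (Y + Z).
Proof.
by move=> Y0 Z0 i j k km; rewrite mxE -[LHS]/(_ + _) Y0 // Z0 // addr0.
Qed.

Lemma vanishM a b Y Z : vanish a Y -> vanish b Z -> vanish (a + b) (Y *m Z).
Proof.
move=> Y0 Z0 i j k kab; rewrite mxE pcoef_sum big1 // => l _.
rewrite -[LHS]/(\sum_(p < k.+1) _) big1 // => p _.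
have [pa|ap] := ltnP p a; first by rewrite Y0 // mul0r.
by rewrite Z0 ?mulr0 //; have := ltn_ord p; lia.
Qed.

Lemma vanish_eq0 Y : (forall m, vanish m Y) -> Y = 0.
Proof.
by move=> Y0; apply/matrixP => i j; rewrite mxE; apply: pseriesP => k; exact: (Y0 k.+1).
Qed.

(* The inverse is the geometric series in X = 1 - W, which converges since
   X^k has no coefficient in degree < k. *)
Lemma invertible_mx_pseries (W : 'M[pseries R]_n) :
  map_mx pcoef0 W = 1%:M -> invertible_mx W.
Proof.
move=> W1; pose X := 1%:M - W.
have X1 : vanish 1 X.
  move=> i j [|//] _; have := congr1 (fun A : 'M_n => val (A i j)) W1.
  rewrite !mxE -[pcoef (_ + _) 0]/(_ + _) /= => ->.
  by case: (i == j); rewrite subrr.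
pose Xk k := iter k (mulmx X) (1%:M).
have XkC k : Xk k *m X = X *m Xk k.
  by elim: k => [|k IH]; rewrite ?mul1mx ?mulmx1 //= -mulmxA -/(Xk k) IH.
have Xk0 k : vanish k (Xk k) by elim: k => // k IH; exact: (vanishM X1 IH).
pose T N := \sum_(k < N) Xk k.
have WT N : W *m T N = 1%:M - Xk N.
  have -> : W = 1%:M - X by rewrite opprB addrC subrK.
  elim: N => [|N IH]; first by rewrite /T big_ord0 mulmx0 subrr.
  rewrite /T big_ord_recr /= mulmxDr -/(T N) IH mulmxBl mul1mx.
  by rewrite addrA subrK.
have TW N : T N *m W = 1%:M - Xk N.
  have -> : W = 1%:M - X by rewrite opprB addrC subrK.
  elim: N => [|N IH]; first by rewrite /T big_ord0 mul0mx subrr.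
  rewrite /T big_ord_recr /= mulmxDl -/(T N) IH mulmxBr mulmx1 XkC.
  by rewrite addrA subrK.
(* The powers X^k with k > m do not reach degree m, so the coefficient of t^m in the full series is
   already that of [T m.+1]. *)
pose G : 'M[pseries R]_n :=
  \matrix_(i, j) mk_pseries (fun m => pcoef_mem (T m.+1 i j) m).
have GT N : vanish N (G - T N).
  move=> i j m; elim: N => // N IH; rewrite ltnS leq_eqVlt => /predU1P[->|mN].
    by rewrite !mxE -[LHS]/(_ - _) subrr.
  have -> : G - T N.+1 = (G - T N) - Xk N.
    by rewrite /T big_ord_recr /= opprD addrA.
  by rewrite mxE -[LHS]/(_ + _) IH // mxE -[pcoef (- _) _]/(- _) Xk0 // subr0.
have Xk0N k : vanish k (- Xk k).
  by move=> i j m mk; rewrite mxE -[LHS]/(- _) Xk0 // oppr0.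
(* W G - 1 = W (G - T m) - X^m vanishes below degree m for every m; the same holds for G W - 1. *)
exists G; split; apply/eqP; rewrite -subr_eq0; apply/eqP/vanish_eq0 => m.
- have -> : W *m G - 1%:M = W *m (G - T m) - Xk m.
    by rewrite mulmxBr WT opprB addrA addrAC addrK.
  by apply: vanishD => //; rewrite -[m]add0n; exact: vanishM.
- have -> : G *m W - 1%:M = (G - T m) *m W - Xk m.
    by rewrite mulmxBl TW opprB addrA addrAC addrK.
  apply: vanishD => //; have := @vanishM m 0 (G - T m) W (GT m).
  by rewrite addn0; apply.
Qed.

End SeriesMatrix.

(** This lets [tr0] factor through the localisation, and makes R_0 itself one of the rings over
    which contractions can be produced. *)
Lemma tr0_inverting : inverting (omega_plus R) (tr0 R).
Proof. by move=> M N s [n A HA]; exact: invertible_mx_tensor. Qed.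

(** Let B lift the inverse of the constant term of U. Then U B and B U have constant term 1, hence
    are invertible, so U has a right inverse B G and a left inverse H B, and these agree. *)
Lemma to_pseries_inverting : inverting (omega_plus R) (to_pseries R).
Proof.
move=> M N s [n A [B0 [AB BA]]]; apply: invertible_mx_tensor.
set U := map_mx _ A; pose B := map_mx (fun r : deg0 R => to_pseries R (val r)) B0.
have U0 : map_mx pcoef0 U = map_mx (tr0 R) A.
  by apply/matrixP => i j; rewrite !mxE pcoef0_to_pseries.
have B00 : map_mx pcoef0 B = B0.
  by apply/matrixP => i j; rewrite !mxE pcoef0_to_pseries tr0_val.
have [G [UBG _]] : invertible_mx (U *m B).
  by apply: invertible_mx_pseries; rewrite map_mxM U0 B00.
have [H [_ HBU]] : invertible_mx (B *m U).
  by apply: invertible_mx_pseries; rewrite map_mxM U0 B00.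
exists (B *m G); split; first by rewrite mulmxA.
suff -> : B *m G = H *m B by rewrite -mulmxA.
by rewrite -[B *m G]mul1mx -HBU -!mulmxA (mulmxA U) UBG mulmx1.
Qed.

Lemma red_zeta (M : lmodType P^c) t : red (tr0 R) (zeta_fun (R := R) (M := M) t) = 0.
Proof.
elim/tensor_ind: t => [|u v Hu Hv|x p]; first by rewrite !raddf0.
  by rewrite !raddfB /= Hu Hv subrr.
rewrite zetaE redZ; have p0 : tr0 R (pge1_val p : P) = 0.
  by apply: val_inj; apply/eqP; exact: (valP p).
apply: etrans (congr1 (fun r : (deg0 R)^c => r *: red (tr0 R) x) p0) _.
exact: scale0r.
Qed.

(** The coordinates c_i(x) lie in P_{>=1}, so x is the image of the sum of e_i (x) c_i(x). *)
Lemma red_eq0_zeta (M : lmodType P^c) (x : M) : fg_free M ->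
  red (tr0 R) x = 0 -> exists t, zeta_fun (R := R) t = x.
Proof.
move=> /dual_bases_ex [n [e [c ec]]] /(red_eq0 _ _ ec) x0.
have c0 i : c i x \in pge1b R.
  by rewrite unfold_in; apply/eqP; exact: (congr1 val (x0 i)).
exists (\sum_i pure (N := pge1_bimodule R) (e i) (PGe1 (c0 i))).
by rewrite raddf_sum [RHS](ec.1 x); apply: eq_bigr => i _; rewrite /= zetaE.
Qed.

(** Every tensor is a sum of e_i (x) w_i, and the w_i are the coordinates of its image. *)
Lemma zeta_inj (M : lmodType P^c) : fg_free M ->
  forall t : tensor M (pge1_bimodule R), zeta_fun t = 0 -> t = 0.
Proof.
move=> /dual_bases_ex [n [e [c ec]]] t.
have [w ->] : exists w : 'I_n -> pge1 R,
    t = \sum_i pure (N := pge1_bimodule R) (e i) (w i).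
  elim/tensor_ind: t => [|u v [p ->] [q ->]|x p].
  - by exists (fun=> 0); rewrite big1 // => i _; rewrite pure0r.
  - exists (fun i => p i - q i); rewrite -sumrB; apply: eq_bigr => i _.
    apply: (addIr (pure (N := pge1_bimodule R) (e i) (q i))).
    by rewrite subrK -pureDr subrK.
  - exists (fun i => @lact _ _ (pge1_bimodule R) (c i x) p).
    rewrite {1}(ec.1 x) pure_suml; apply: eq_bigr => i _.
    by rewrite pureZ.
rewrite raddf_sum => /= w0; rewrite big1 // => i _.
suff -> : w i = 0 by rewrite pure0r.
apply: val_inj; rewrite -[RHS](raddf0 (c i)) -w0.
apply: etrans (esym (coord_comb ec (fun j => (pge1_val (w j) : P^c)) i)) _.
by congr (c i _); apply: eq_bigr => j _; rewrite zetaE.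
Qed.

(* The matrix A of phi in a basis satisfies tr0 A = 1. *)
Lemma red_id_bij (S : pzRingType) (f : {rmorphism P -> S}) (M : lmodType P^c)
    (phi : {linear M -> M}) : inverting (omega_plus R) f -> fg_free M ->
  (forall x, red (tr0 R) (phi x) = red (tr0 R) x) ->
  bijective (tensor_map phi (ring_bimodule f)).
Proof.
move=> f_inv /dual_bases_ex [n [e [c ec]]] phi1.
pose A : 'M[P]_n := \matrix_(i, j) c i (phi (e j)).
have A1 : map_mx (tr0 R) A = 1%:M.
  apply/matrixP => i j; rewrite !mxE.
  have ce : c i (e j) = (i == j)%:R :> P := ec.2 i j.
  have /(red_coord (c i)) E : red (tr0 R) (phi (e j) - e j) = 0.
    by rewrite raddfB /= phi1 subrr.
  have : tr0 R ((c i (phi (e j)) : P) - (i == j)%:R) = 0.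
    rewrite -ce; apply: etrans E; congr (tr0 R _).
    exact: esym (raddfB (c i) _ _).
  by rewrite rmorphB rmorph_nat => /eqP; rewrite subr_eq0 => /eqP.
have Ainv : invertible_mx (map_mx (tr0 R) A).
  by rewrite A1; exists 1%:M; rewrite mulmx1.
pose to (x : M) : 'cV[P^c]_n := \col_i (c i x : P^c).
have toL : linear to by move=> a x y; apply/matrixP => i j; rewrite !mxE linearP.
pose from (v : 'cV[P^c]_n) : M := \sum_i (v i 0 : P^c) *: e i.
have fromL : linear from.
  move=> a u v; rewrite /from scaler_sumr -big_split /=; apply: eq_bigr => i _.
  by rewrite !mxE scalerDl scalerA.
pose Lto : {linear M -> 'cV[P^c]_n} :=
  HB.pack to (GRing.isLinear.Build _ _ _ _ to toL).
pose Lfrom : {linear 'cV[P^c]_n -> M} :=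
  HB.pack from (GRing.isLinear.Build _ _ _ _ from fromL).
have toK x : Lfrom (Lto x) = x.
  by rewrite [RHS](ec.1 x); apply: eq_bigr => i _; rewrite mxE.
have fromK v : Lto (Lfrom v) = v.
  apply/matrixP => i j; rewrite mxE ord1.
  exact: (coord_comb ec).
have toA x : Lto (phi x) = mx_hom A (Lto x).
  apply/matrixP => i j; rewrite !mxE {1}(ec.1 x) !linear_sum /=.
  by apply: eq_bigr => k _; rewrite !mxE !linearZ.
pose N := ring_bimodule f.
have bij_to : bijective (tensor_map Lto N).
  exists (tensor_map Lfrom N) => t.
    by rewrite -(@tensor_map_comp _ _ _ _ _ N Lto Lfrom idfun) // tensor_map_id.
  by rewrite -(@tensor_map_comp _ _ _ _ _ N Lfrom Lto idfun) // tensor_map_id.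
have bij_from : bijective (tensor_map Lfrom N).
  exists (tensor_map Lto N) => t.
    by rewrite -(@tensor_map_comp _ _ _ _ _ N Lfrom Lto idfun) // tensor_map_id.
  by rewrite -(@tensor_map_comp _ _ _ _ _ N Lto Lfrom idfun) // tensor_map_id.
have bij_A := f_inv _ _ _ (OmegaPlus Ainv).
(* Conjugating A by the coordinate isomorphisms gives back phi. *)
apply: (eq_bij (bij_comp bij_from (bij_comp bij_A bij_to))) => t /=.
elim/tensor_ind: t => [|u v Hu Hv|x s]; first by rewrite !raddf0.
  by rewrite !raddfB /= Hu Hv.
rewrite !tensor_mapE; congr (pure _ _).
exact: etrans (congr1 from (esym (toA x))) (toK (phi x)).
Qed.

End Graded.

(** * Contractions of C modulo the kernel of reduction *)

Section FreeComplex.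
Variables (P : pzRingType) (R : grading P).
Variable C : complex P.
Hypothesis C_free : forall k, fg_free (C k).
Local Notation r0 := (red (tr0 R)).
Local Notation d := (cdiff C _).

Lemma tr0_surj r : exists a, tr0 R a = r.
Proof. by exists (val r); exact: tr0_val. Qed.

(** The link between all four conditions: maps on C itself that satisfy the contraction equation
    only after reduction to R_0. *)
Definition contraction_mod (s : forall k, {linear C k -> C (k + 1)}) : Prop :=
  forall k (x : C (k + 1)), r0 (d (s (k + 1) x) + s k (d x)) = r0 x.

Lemma red_congr (M N : lmodType P^c) (g : {linear M -> N}) x y :
  r0 x = r0 y -> r0 (g x) = r0 (g y).
Proof. by rewrite -!tensor_map_red => ->. Qed.

(** Since [tr0] is surjective, so is reduction, and the composite of s with reduction lifts through
    it because the C_k are free. *)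
Lemma contractible_lift : contractible (base_change C (tr0 R)) ->
  exists s, contraction_mod s.
Proof.
move=> [s sP].
have /dep_choice [t tE] : forall k, exists t : {linear C k -> C (k + 1)},
    forall x, r0 (t x) = s k (r0 x).
  move=> k; apply: (@free_lift _ _ _ (fun x y => r0 y = s k (r0 x)) (C_free k))
    => [x||a x x' y y' xy xy'].
  - by have [y ->] := red_surj tr0_surj (s k (r0 x)); exists y.
  - by rewrite !raddf0.
  - by rewrite !raddfD /= !redZ linearZ /= xy xy'.
exists t => k x; rewrite raddfD /= tE -tensor_map_red tE -tensor_map_red.
exact: sP.
Qed.

(* phi = ds + sd becomes an isomorphism over S and commutes with d, so
   phi^-1 s is a contraction. *)
Lemma contraction_mod_contractible (S : pzRingType) (f : {rmorphism P -> S}) s :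
  inverting (omega_plus R) f -> contraction_mod s ->
  contractible (base_change C f).
Proof.
move=> f_inv sP; set N := ring_bimodule f.
pose phi k : {linear C (k + 1) -> C (k + 1)} :=
  (cdiff C (k + 1) \o s (k + 1)) \+ (s k \o cdiff C k).
have /dep_choice [psi psiP] k :=
  linear_inverse (red_id_bij f_inv (C_free (k + 1))
    (sP k : forall x, r0 (phi k x) = r0 x)).
pose sN k : {linear tensor (C k) N -> tensor (C (k + 1)) N} := tensor_map (s k) N.
pose dN k : {linear tensor (C (k + 1)) N -> tensor (C k) N} :=
  tensor_map (cdiff C k) N.
have phiE k t : tensor_map (phi k) N t = dN _ (sN _ t) + sN _ (dN _ t).
  elim/tensor_ind: t => [|u v Hu Hv|x a].
  - by rewrite !raddf0 addr0.
  - by rewrite !raddfB /= Hu Hv opprD addrACA.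
  - by rewrite /sN /dN /= !tensor_mapE /= pureDl.
have dd k t : dN k (dN (k + 1) t) = 0.
  exact: (@cdiffK _ (base_change C f) k t).
(* Both sides equal d s d, because d d = 0. *)
have dphi k t : dN _ (tensor_map (phi (k + 1)) N t) = tensor_map (phi k) N (dN _ t).
  by rewrite !phiE raddfD /= !dd raddf0 add0r addr0.
have dpsi k t : dN _ (psi (k + 1) t) = psi k (dN _ t).
  transitivity (psi k (tensor_map (phi k) N (dN _ (psi (k + 1) t)))).
    exact: esym ((psiP k).1 _).
  rewrite -dphi; congr (psi k (dN _ _)).
  exact: (psiP (k + 1)).2.
exists (fun k => psi k \o tensor_map (s k) N) => k t /=.
rewrite -/(dN (k + 1)) dpsi -raddfD /= -[RHS](psiP k).1; congr (psi k _).
exact: esym (phiE k t).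
Qed.

Lemma zetaN k t : zeta_fun (tensor_map (cdiff C k) (pge1_bimodule R) t) =
  cdiff C k (zeta_fun t).
Proof. exact: (cmapC (zeta R C)). Qed.

(** If d y reduces to 0, then so does y - d s y, which therefore lies in the image of zeta. For d y
    = 0 this gives surjectivity on homology; for d y = zeta t, injectivity of zeta turns it into a
    t' with t = d t'. *)
Lemma contraction_mod_quasi_iso s : contraction_mod s -> quasi_iso (zeta R C).
Proof.
move=> sP k; apply: homology_map_bij => [t y dt ty|y dy].
  have [|t' t'E] := @red_eq0_zeta _ R (C (k + 1 + 1)) (y - d (s _ y)) (C_free _).
    have := sP _ y; rewrite raddfB raddfD /= => <-.
    rewrite [LHS]addrC addKr -ty -tensor_map_red.
    by rewrite [X in tensor_map _ _ X]red_zeta raddf0.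
  exists t'; apply/eqP; rewrite -subr_eq0; apply/eqP/zeta_inj => //.
  rewrite raddfB /= zetaN t'E raddfB /= cdiffK subr0.
  by apply/eqP; rewrite subr_eq0; apply/eqP.
have [|t tE] := @red_eq0_zeta _ R (C (k + 1)) (y - d (s _ y)) (C_free _).
  have := sP _ y; rewrite dy raddf0 addr0 raddfB /= => ->.
  by rewrite subrr.
exists t, (s _ y); split; last by rewrite [zeta R C _ _]tE subrK.
by apply: zeta_inj => //; rewrite zetaN tE raddfB /= cdiffK dy subrr.
Qed.

(** * From a quasi-isomorphism zeta to a contraction modulo the kernel *)

Section Acyclic.
Hypothesis C_bounded : bounded C.
Hypothesis zeta_qi : quasi_iso (zeta R C).

(** Acyclicity of C (x) R_0, expressed on representatives. Write d x = zeta t with t a cycle.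
    Injectivity on homology gives t = d t', so x - zeta t' is a cycle; by surjectivity it equals
    zeta u + d z, and the zeta terms reduce to 0. *)
Lemma red_acyclic k (x : C (k + 1)) : r0 (d x) = 0 -> exists z, r0 x = r0 (d z).
Proof.
(* Homology is indexed by degrees of the form j + 1, and the class of t lives in degree k. *)
have [j jk] : exists j, k = j + 1 by exists (k - 1); rewrite subrK.
subst k => /(red_eq0_zeta (C_free _)) [t tE].
have dt : tensor_map (cdiff C j) (pge1_bimodule R) t = 0.
  by apply: zeta_inj => //; rewrite zetaN tE cdiffK.
have [t' t'E] := homology_map_inj (bij_inj (zeta_qi j))
  (dt : cdiff (tensor_complex _ _) _ _ = 0) tE.
have cyc : d (x - zeta_fun t') = 0.
  by rewrite raddfB /= -zetaN -tE {1}t'E subrr.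
have surj h' : exists h, homology_map (zeta R C) (j + 1) h = h'.
  by have [g _ gK] := zeta_qi (j + 1); exists (g h').
have [u [z [_ uz]]] := homology_map_surj surj cyc.
exists z; rewrite -[x](subrK (zeta_fun t')) uz !raddfD /=.
apply: etrans (congr2 (fun a b => a + r0 (d z) + b) (red_zeta u) (red_zeta t')) _.
exact: etrans (addr0 _) (add0r _).
Qed.

(* By induction on k: t_(k+1) lifts 1 - t_k d, which takes values in the cycles
   modulo the kernel of red, along d. *)
Lemma partial_inverse k : exists t : {linear C k -> C (k + 1)},
  forall x : C (k + 1), r0 (d (t (d x))) = r0 (d x).
Proof.
have [n n0] := C_bounded.
(* In degrees at most - n - 1 the modules are zero, so the zero map serves. *)
have base k0 : k0 <= - n%:Z - 1 -> exists t : {linear C k0 -> C (k0 + 1)},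
    forall x : C (k0 + 1), r0 (d (t (d x))) = r0 (d x).
  move=> k0n; exists \0 => x; rewrite [in RHS](n0 k0 _ (cdiff C k0 x)); last lia.
  by rewrite /= !raddf0.
have step (k0 : int) : (exists t : {linear C k0 -> C (k0 + 1)},
    forall x : C (k0 + 1), r0 (d (t (d x))) = r0 (d x)) ->
    exists t : {linear C (k0 + 1) -> C (k0 + 1 + 1)},
    forall x : C (k0 + 1 + 1), r0 (d (t (d x))) = r0 (d x).
  move=> [t tP].
  pose h : {linear C (k0 + 1) -> C (k0 + 1)} := idfun \- (t \o cdiff C k0).
  have [||a x x' y y' xy xy'|t' t'P] := @free_lift _ _ (C (k0 + 1 + 1))
    (fun x y => r0 (d y) = r0 (h x)) (C_free (k0 + 1)).
  - move=> x; have [|z zE] := @red_acyclic _ (x - t (d x)); last by exists z.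
    by rewrite raddfB /= raddfB /= tP subrr.
  - by rewrite !raddf0.
  - rewrite (linearP (cdiff C (k0 + 1))) (linearP h) [LHS]raddfD [RHS]raddfD /=.
    by rewrite !redZ xy xy'.
  (* On boundaries h is the identity, since d d = 0. *)
  - by exists t' => x; rewrite t'P /= cdiffK raddf0 subr0.
have [kn|nk] : k <= - n%:Z - 1 \/ - n%:Z - 1 < k by lia.
  exact: base.
have [m ->] : exists m : nat, k = - n%:Z - 1 + m%:Z.
  by exists (absz (k + n%:Z + 1)%R); lia.
elim: m => [|m IH]; first by apply: base; rewrite addr0.
by have := step _ IH; rewrite -addrA -PoszD addn1.
Qed.

(** Modulo the kernel, d t is the identity on boundaries, hence by acyclicity on cycles, in
    particular on x - t d x. The missing term t d x is s d x, because 1 - t d fixes boundaries. *)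
Lemma quasi_iso_contraction_mod : exists s, contraction_mod s.
Proof.
have [t tP] := dep_choice partial_inverse.
have tK k (x : C (k + 1)) : r0 (d x) = 0 -> r0 (d (t _ x)) = r0 x.
  move=> /red_acyclic [z xz]; rewrite xz -[RHS]tP.
  exact: (red_congr (cdiff C (k + 1)) (red_congr (t (k + 1)) xz)).
(* The contraction is s_k = t_k (1 - t_(k-1) d); quantifying over the equation e
   avoids a transport along k - 1 + 1 = k in its definition. *)
have /dep_choice [q qE] k : exists q : {linear C k -> C k},
    forall j (e : j + 1 = k) (x : C (j + 1)),
    q (eq_rect _ (fun i => C i) x _ e) =
    eq_rect _ (fun i => C i) (x - t j (d x)) _ e.
  have [j jk] : exists j, k = j + 1 by exists (k - 1); rewrite subrK.
  subst k; exists (idfun \- (t j \o cdiff C j)) => i e.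
  have ij : i = j by exact: (addIr 1 e).
  by subst i; rewrite (eq_irrelevance e erefl).
exists (fun k => t k \o q k) => k x /=.
have td : t k (q k (d x)) = t k (d x).
  have [j jk] : exists j, k = j + 1 by exists (k - 1); rewrite subrK.
  by subst k; rewrite (qE _ j erefl) /= cdiffK raddf0 subr0.
rewrite td (qE _ k erefl) /= raddfD /= tK.
  by rewrite raddfB /= subrK.
by rewrite !raddfB /= tP subrr.
Qed.

End Acyclic.
End FreeComplex.

Theorem theorem5p4 (P : pzRingType) (R : grading P) (C : complex P)
    (C_bounded : bounded C) (C_free : forall k : int, fg_free (C k))
    (L : pzRingType) (lambda : {rmorphism P -> L})
    (L_loc : is_localisation (omega_plus R) lambda) :
  [<-> contractible (base_change C (tr0 R));
       contractible (base_change C (to_pseries R));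
       contractible (base_change C lambda);
       quasi_iso (zeta R C)].
Proof.
have from1 (S : pzRingType) (f : {rmorphism P -> S}) : inverting (omega_plus R) f ->
    contractible (base_change C (tr0 R)) -> contractible (base_change C f).
  move=> f_inv /(contractible_lift C_free) [s].
  exact: contraction_mod_contractible.
(* The universal property extends [tr0] along [lambda], which gives the descent from L to R_0. *)
have [g gE _] := L_loc.2 _ _ (@tr0_inverting _ R).
(* The implications 2 to 3 and 3 to 4 both pass through condition 1. *)
split; last split; last split.
- exact/from1/to_pseries_inverting.
- move=> C2; apply: from1; first exact: L_loc.1.
  exact: (contractible_comp (@pcoef0_to_pseries _ R)).
- move=> /(contractible_comp gE) /(contractible_lift C_free) [s].
  exact: contraction_mod_quasi_iso.
- move=> /(quasi_iso_contraction_mod C_free C_bounded) [s].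
  exact: (contraction_mod_contractible C_free (@tr0_inverting _ R)).
Qed.
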